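(* There exists a sequence of Boolean functions $f_1,f_2,\ldots$ such that $f_j$ uses $O(2^j)$ variables, every compressed SDD representing $f_j$ has size $\Omega(2^j)$ with respect to any vtree, and there is a vtree with respect to which a compressed VS-SDD representing $f_j$ has size $O(j)$.
   Context: A vtree over a set of variables is an ordered full binary tree whose leaves are in one-to-one correspondence with the variables; $l(x)$ is the variable of leaf $x$; nodes have integer IDs $\mathtt{ID}(x)$ assigned in preorder, $\mathtt{ID}^{-1}(i)$ the node with ID $i$. $y$ is a left (right) descendant of $x$ if it is a (not necessarily proper) descendant of the left (right) child of $x$. For disjoint $\mathbf{X},\mathbf{Y}$, an $\mathbf{X}$-partition of $f(\mathbf{X},\mathbf{Y})$ is $f=\bigvee_{i=1}^n[p_i(\mathbf{X})\wedge s_i(\mathbf{Y})]$ with pairwise disjoint primes $p_i$, $\bigvee p_i=\mathit{true}$, $p_i\ne\mathit{false}$; it is compressed if the subs $s_i$ are pairwise distinct. SDD respecting vtree node $x$: $\top,\bot$ (true/false); literals $X,\neg X$ with $x$ the leaf of $X$; decompositions $\{(p_1,s_1),\ldots,(p_n,s_n)\}$ with $x$ internal, $p_i$ SDDs respecting left descendants of $x$, $s_i$ SDDs respecting right descendants of $x$, $\langle p_i\rangle$ forming a partition, semantics $\bigvee_i\langle p_i\rangle\wedge\langle s_i\rangle$. Size = sum over decomposition nodes of their number of elements. An SDD is compressed if all its partitions are compressed. A VS-SDD is a pair $(\alpha,k)$ of a structure and integer offset: $\top,\bot$ constants; literal $\mathbf{v}$ ($\neg\mathbf{v}$) with $\mathtt{ID}^{-1}(k)$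 a leaf means $l(\mathtt{ID}^{-1}(k))$ (its negation); decomposition $\{([p_i,d_i],[s_i,e_i])\}_{i=1}^n$ with $\mathtt{ID}^{-1}(k)$ internal, $\mathtt{ID}^{-1}(d_i+k)$ a left and $\mathtt{ID}^{-1}(e_i+k)$ a right descendant of $\mathtt{ID}^{-1}(k)$, $\langle p_i,d_i+k\rangle$ forming a partition, meaning $\bigvee_i\langle p_i,d_i+k\rangle\wedge\langle s_i,e_i+k\rangle$. Structures are DAG nodes; identical structures are shared only when their offsets correspond to vtree nodes with isomorphic subtrees. Size = sum over distinct decomposition nodes of the number of elements. A VS-SDD is compressed if every decomposition in it forms a compressed partition. *)

(* Defs.v *)
From HB Require Import structures.
From mathcomp Require Import all_boot all_order all_algebra.

Set Implicit Arguments.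
Unset Strict Implicit.
Unset Printing Implicit Defensive.

(** * Boolean functions and partitions *)

Definition assignment (V : finType) := {ffun V -> bool}.
Definition bfun (V : finType) := {ffun assignment V -> bool}.

Section Partitions.
Variable V : finType.

(* Pairwise disjoint primes, covering every assignment, none of them false.
   That the primes depend on the left and the subs on the right variables only
   is ensured by the vtree conditions in [sdd_respects] and [vs_wf]. *)
Definition is_partition (ps : seq (bfun V)) : bool :=
  [&& pairwise (fun p q : bfun V => [forall a, ~~ (p a && q a)]) ps,
      [forall a, has (fun p : bfun V => p a) ps]
    & all (fun p : bfun V => p != [ffun=> false]) ps].

End Partitions.

(** * Vtrees *)

Inductive vtree (V : Type) : Type :=
| VLeaf of V
| VNode of vtree V & vtree V.

Fixpoint vtree_enc (V : Type) (t : vtree V) : GenTree.tree V :=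
  match t with
  | VLeaf v => GenTree.Leaf v
  | VNode l r => GenTree.Node 0 [:: vtree_enc l; vtree_enc r]
  end.

Fixpoint vtree_dec (V : Type) (t : GenTree.tree V) : option (vtree V) :=
  match t with
  | GenTree.Leaf v => Some (VLeaf v)
  | GenTree.Node _ [:: l; r] =>
      if (vtree_dec l, vtree_dec r) is (Some l', Some r')
      then Some (VNode l' r') else None
  | _ => None
  end.

Lemma vtree_encK (V : Type) : pcancel (@vtree_enc V) (@vtree_dec V).
Proof. by elim=> //= l -> r ->. Qed.

HB.instance Definition _ (V : eqType) :=
  Equality.copy (vtree V) (pcan_type (@vtree_encK V)).

Fixpoint leaves (V : Type) (t : vtree V) : seq V :=
  match t with
  | VLeaf v => [:: v]
  | VNode l r => leaves l ++ leaves r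
  end.

Definition vtree_over (V : finType) (t : vtree V) : bool :=
  perm_eq (leaves t) (enum V).

(* A node of a vtree is represented by the subtree rooted at it; since the
   leaves carry distinct variables, distinct nodes have distinct subtrees.
   Thus [y \in preorder x] says that y is a (not necessarily proper) descendant
   of x. *)
Fixpoint preorder (V : Type) (t : vtree V) : seq (vtree V) :=
  t :: (if t is VNode l r then preorder l ++ preorder r else [::]).

(* IDs are numbered from 0; only differences of IDs matter below. *)
Definition ID_inv (V : Type) (t : vtree V) (k : int) : option (vtree V) :=
  if k is Posz i then onth (preorder t) i else None.

(* Two vtree nodes have isomorphic subtrees iff they have the same shape. *)
Fixpoint vshape (V : Type) (t : vtree V) : vtree unit :=
  match t with
  | VLeaf _ => VLeaf tt
  | VNode l r => VNode (vshape l) (vshape r)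
  end.

(** * SDDs *)

(* [SLit true v] is the literal v and [SLit false v] its negation. *)
Inductive sdd (V : Type) : Type :=
| STop
| SBot
| SLit of bool & V
| SDec of seq (sdd V * sdd V).

Arguments STop {V}.
Arguments SBot {V}.

Fixpoint sdd_enc (V : Type) (a : sdd V) : GenTree.tree V :=
  match a with
  | STop => GenTree.Node 0 [::]
  | SBot => GenTree.Node 1 [::]
  | SLit b v => GenTree.Node (if b then 2 else 3) [:: GenTree.Leaf v]
  | SDec es => GenTree.Node 4
      [seq GenTree.Node 0 [:: sdd_enc e.1; sdd_enc e.2] | e <- es]
  end.

Fixpoint sdd_dec (V : Type) (t : GenTree.tree V) : option (sdd V) :=
  match t with
  | GenTree.Node 0 _ => Some STop
  | GenTree.Node 1 _ => Some SBot
  | GenTree.Node 2 [:: GenTree.Leaf v] => Some (SLit true v)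
  | GenTree.Node 3 [:: GenTree.Leaf v] => Some (SLit false v)
  | GenTree.Node 4 ts => Some (SDec (pmap (fun u : GenTree.tree V =>
      if u is GenTree.Node _ [:: p; s] then
        if (sdd_dec p, sdd_dec s) is (Some p', Some s')
        then Some (p', s') else None
      else None) ts))
  | _ => None
  end.

Fixpoint sdd_encK (V : Type) (a : sdd V) : sdd_dec (sdd_enc a) = Some a.
Proof.
case: a => [||[] v|es] //=; congr (Some (SDec _)).
by elim: es => [|[p s] es IHes] //=; rewrite !sdd_encK /= IHes.
Defined.

HB.instance Definition _ (V : eqType) :=
  Equality.copy (sdd V) (pcan_type (@sdd_encK V)).

Section SDD.
Variable V : finType.

Fixpoint sdd_eval (a : sdd V) (x : assignment V) : bool :=
  match a with
  | STop => true
  | SBot => false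
  | SLit b v => x v == b
  | SDec es => has (fun e => sdd_eval e.1 x && sdd_eval e.2 x) es
  end.

Definition sdd_fun (a : sdd V) : bfun V := [ffun x => sdd_eval a x].

Fixpoint sdd_respects (x : vtree V) (a : sdd V) {struct a} : bool :=
  match a with
  | STop | SBot => true
  | SLit _ v => x == VLeaf v
  | SDec es =>
      if x is VNode l r then
        all (fun e => has (fun y => sdd_respects y e.1) (preorder l)
                   && has (fun y => sdd_respects y e.2) (preorder r)) es
        && is_partition [seq sdd_fun e.1 | e <- es]
      else false
  end.

Definition sdd_wrt (t : vtree V) (a : sdd V) : bool :=
  has (fun x => sdd_respects x a) (preorder t).

Fixpoint sdd_compressed (a : sdd V) : bool :=
  if a is SDec es then
    all (fun e => sdd_compressed e.1 && sdd_compressed e.2) es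
    && uniq [seq sdd_fun e.2 | e <- es]
  else true.

Fixpoint sdd_decs (a : sdd V) : seq (seq (sdd V * sdd V)) :=
  if a is SDec es
  then es :: flatten [seq sdd_decs e.1 ++ sdd_decs e.2 | e <- es]
  else [::].

(* An SDD is a DAG in which identical subdiagrams are one node. *)
Definition sdd_size (a : sdd V) : nat :=
  \sum_(es <- undup (sdd_decs a)) size es.

End SDD.

(** * VS-SDDs *)

(* [VSLit true] is the structure v and [VSLit false] its negation. *)
Inductive vstruct : Type :=
| VSTop
| VSBot
| VSLit of bool
| VSDec of seq ((vstruct * int) * (vstruct * int)).

Fixpoint vstruct_enc (a : vstruct) : GenTree.tree int :=
  match a with
  | VSTop => GenTree.Node 0 [::]
  | VSBot => GenTree.Node 1 [::]
  | VSLit b => GenTree.Node (if b then 2 else 3) [::]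
  | VSDec es => GenTree.Node 4
      [seq GenTree.Node 0 [:: vstruct_enc e.1.1; GenTree.Leaf e.1.2;
                              vstruct_enc e.2.1; GenTree.Leaf e.2.2] | e <- es]
  end.

Fixpoint vstruct_dec (t : GenTree.tree int) : option vstruct :=
  match t with
  | GenTree.Node 0 _ => Some VSTop
  | GenTree.Node 1 _ => Some VSBot
  | GenTree.Node 2 _ => Some (VSLit true)
  | GenTree.Node 3 _ => Some (VSLit false)
  | GenTree.Node 4 ts => Some (VSDec (pmap (fun u : GenTree.tree int =>
      if u is GenTree.Node _ [:: p; GenTree.Leaf d; s; GenTree.Leaf e] then
        if (vstruct_dec p, vstruct_dec s) is (Some p', Some s')
        then Some ((p', d), (s', e)) else None
      else None) ts))
  | _ => None
  end.

Fixpoint vstruct_encK (a : vstruct) : vstruct_dec (vstruct_enc a) = Some a.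
Proof.
case: a => [||[]|es] //=; congr (Some (VSDec _)).
by elim: es => [|[[p d] [s e]] es IHes] //=; rewrite !vstruct_encK /= IHes.
Defined.

HB.instance Definition _ :=
  Equality.copy vstruct (pcan_type vstruct_encK).

Section VSSDD.
Variables (V : finType) (t : vtree V).
Local Open Scope ring_scope.

(* For a literal whose offset is not the ID of a leaf the value is irrelevant:
   such a pair is not well formed. *)
Fixpoint vs_eval (a : vstruct) (k : int) (x : assignment V) : bool :=
  match a with
  | VSTop => true
  | VSBot => false
  | VSLit b => if ID_inv t k is Some (VLeaf v) then x v == b else false
  | VSDec es =>
      has (fun e => vs_eval e.1.1 (e.1.2 + k) x
                 && vs_eval e.2.1 (e.2.2 + k) x) es
  end.

Definition vs_fun (a : vstruct) (k : int) : bfun V := [ffun x => vs_eval a k x].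

Definition ID_in (k : int) (y : vtree V) : bool :=
  if ID_inv t k is Some z then z \in preorder y else false.

Fixpoint vs_wf (a : vstruct) (k : int) : bool :=
  match a with
  | VSTop | VSBot => true
  | VSLit _ => if ID_inv t k is Some (VLeaf _) then true else false
  | VSDec es =>
      if ID_inv t k is Some (VNode l r) then
        all (fun e => [&& ID_in (e.1.2 + k) l, vs_wf e.1.1 (e.1.2 + k),
                          ID_in (e.2.2 + k) r & vs_wf e.2.1 (e.2.2 + k)]) es
        && is_partition [seq vs_fun e.1.1 (e.1.2 + k) | e <- es]
      else false
  end.

Fixpoint vs_compressed (a : vstruct) (k : int) : bool :=
  if a is VSDec es then
    all (fun e => vs_compressed e.1.1 (e.1.2 + k)
               && vs_compressed e.2.1 (e.2.2 + k)) es
    && uniq [seq vs_fun e.2.1 (e.2.2 + k) | e <- es]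
  else true.

(* A decomposition node of the DAG is determined by its structure together with
   the isomorphism type of the subtree at its absolute offset: identical
   structures are shared exactly when these subtrees are isomorphic. *)
Fixpoint vs_decs (a : vstruct) (k : int) :
    seq (seq ((vstruct * int) * (vstruct * int)) * option (vtree unit)) :=
  if a is VSDec es then
    (es, omap (@vshape V) (ID_inv t k))
      :: flatten [seq vs_decs e.1.1 (e.1.2 + k) ++ vs_decs e.2.1 (e.2.2 + k)
                 | e <- es]
  else [::].

Definition vs_size (a : vstruct) (k : int) : nat :=
  (\sum_(u <- undup (vs_decs a k)) size u.1)%N.

End VSSDD.

(** * Asymptotics *)

Definition bigO (g h : nat -> nat) : Prop :=
  exists C N : nat, forall j, N <= j -> g j <= C * h j.

(* g >= c h eventually, for a constant c > 0; here c = 1 / C. *)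
Definition bigOmega (g h : nat -> nat) : Prop :=
  exists C N : nat, 0 < C /\ forall j, N <= j -> h j <= C * g j.

(* Main.v *)
Require Import Defs.
From HB Require Import structures.
From mathcomp Require Import all_boot all_order all_algebra.

Set Implicit Arguments.
Unset Strict Implicit.
Unset Printing Implicit Defensive.

(** The witness [f_j] is the parity of [2 ^ j] variables. Parity depends on every
    variable, so each variable labels a literal of any SDD for it; once the SDD is
    not itself a literal, each such literal is a prime or a sub of some element,
    and an element has only two of these. Over the perfect vtree, the parity (or
    its negation) at a node is decomposed into parities and negated parities at
    the two children, by a structure that depends only on the height of the node:
    sharing leaves two decompositions of two elements each per height. *)

(** * Parity of a list of variables *)

Definition parity (V : Type) (vs : seq V) (x : V -> bool) : bool :=
  \big[addb/false]_(v <- vs) x v.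

Lemma parity_indicator (V : eqType) (vs : seq V) (v : V) :
  uniq vs -> v \in vs -> parity vs (pred1 v) = true.
Proof.
move=> uvs vin; rewrite /parity (bigD1_seq v) //= eqxx big1 // => w.
by move/negbTE.
Qed.

(** Setting a single variable makes the parity odd, setting none makes it even. This is what keeps
    the primes of the parity decompositions from being false. *)
Lemma parity_surj (V : finType) (vs : seq V) (b : bool) :
  uniq vs -> vs != [::] -> exists x : assignment V, parity vs x = b.
Proof.
case: vs => // v vs uvs _; case: b.
  exists [ffun w => w == v]; rewrite -[RHS](parity_indicator uvs (mem_head v vs)).
  by apply: eq_bigr => w _; rewrite ffunE.
by exists [ffun=> false]; rewrite /parity big1 // => w _; rewrite ffunE.
Qed.

(** * Lower bound: variables of an SDD against its size *)

Section LowerBound.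
Variable V : finType.

Definition literal_vars (a : sdd V) : seq V :=
  if a is SLit _ v then [:: v] else [::].

Definition elements_literal_vars (es : seq (sdd V * sdd V)) : seq V :=
  flatten [seq literal_vars e.1 ++ literal_vars e.2 | e <- es].

(** Variables are grouped by decomposition, so that they can be counted against [sdd_size], which
    sums over decompositions. A literal at the root lies in no decomposition and is added in
    front. *)
Definition sdd_vars (a : sdd V) : seq V :=
  literal_vars a ++ flatten [seq elements_literal_vars es | es <- sdd_decs a].

Lemma sdd_vars_elements (es : seq (sdd V * sdd V)) (e : sdd V * sdd V) :
  e \in es ->
  {subset sdd_vars e.1 ++ sdd_vars e.2 <= sdd_vars (SDec es)}.
Proof.
move=> ein v; rewrite /sdd_vars /= !mem_cat.
have inhead : v \in literal_vars e.1 ++ literal_vars e.2 ->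
    v \in elements_literal_vars es.
  by move=> vin; apply/flatten_mapP; exists e.
have intail : forall c, c \in sdd_decs e.1 ++ sdd_decs e.2 ->
    v \in elements_literal_vars c ->
    v \in flatten [seq elements_literal_vars c | c <-
            flatten [seq sdd_decs e.1 ++ sdd_decs e.2 | e <- es]].
  move=> c cin vin; apply/flatten_mapP; exists c => //.
  by apply/flatten_mapP; exists e.
move: inhead; rewrite mem_cat => inhead.
case/orP=> /orP[vin|/flatten_mapP[c cin vin]].
- by rewrite inhead ?vin.
- by rewrite (intail c) ?orbT // mem_cat cin.
- by rewrite inhead ?vin ?orbT.
- by rewrite (intail c) ?orbT // mem_cat cin orbT.
Qed.

Fixpoint sdd_eval_ext (a : sdd V) (x y : assignment V) {struct a} :
  {in sdd_vars a, x =1 y} -> sdd_eval a x = sdd_eval a y.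
Proof.
case: a => [||b v|es] //= eqxy; first by rewrite eqxy // mem_head.
have {}eqxy : forall e, e \in es -> {in sdd_vars e.1 ++ sdd_vars e.2, x =1 y}.
  by move=> e ein v /(sdd_vars_elements ein)/eqxy.
(* [sdd] is nested in a list of pairs: an inner induction on the elements makes the recursive calls
   on prime and sub. *)
elim: es eqxy => [|[p s] es IHes] //= eqxy.
have eqps v : v \in sdd_vars p ++ sdd_vars s -> x v = y v.
  by apply: (eqxy (p, s)); rewrite mem_head.
rewrite (sdd_eval_ext p x y) => [|v vin]; last by rewrite eqps // mem_cat vin.
rewrite (sdd_eval_ext s x y) => [|v vin]; last first.
  by rewrite eqps // mem_cat vin orbT.
by rewrite IHes // => e ein; apply: eqxy; rewrite inE ein orbT.
Qed.

Lemma size_literal_vars (a : sdd V) : size (literal_vars a) <= 1.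
Proof. by case: a. Qed.

Lemma size_elements_literal_vars (es : seq (sdd V * sdd V)) :
  size (elements_literal_vars es) <= 2 * size es.
Proof.
rewrite /elements_literal_vars; elim: es => //= e es IHes.
rewrite !size_cat mulnS leq_add //.
exact: leq_add (size_literal_vars _) (size_literal_vars _).
Qed.

(** With two or more variables the root is not a literal, so every variable occurs in some element.
    Removing repeated decompositions loses no variable, and each element supplies at most two. *)
Lemma card_le_sdd_size (a : sdd V) :
  1 < #|V| -> (forall v, v \in sdd_vars a) -> #|V| <= 2 * sdd_size a.
Proof.
move=> V_gt1 allin; have leV (s : seq V) : (forall v, v \in s) -> #|V| <= size s.
  by move=> sin; rewrite cardE uniq_leq_size ?enum_uniq.
have nolit : literal_vars a = [::].
  by case: a allin => // b v /leV /=; rewrite leqNgt V_gt1.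
pose s := flatten [seq elements_literal_vars es | es <- undup (sdd_decs a)].
apply: (@leq_trans (size s)).
  apply: leV => v; have := allin v; rewrite /sdd_vars nolit /=.
  case/flatten_mapP=> es esin vin.
  by apply/flatten_mapP; exists es; rewrite ?mem_undup.
rewrite /s /sdd_size size_flatten /shape -map_comp sumnE big_map big_distrr /=.
by apply: leq_sum => es _; apply: size_elements_literal_vars.
Qed.

Lemma parity_sdd_vars (a : sdd V) (b : bool) :
  sdd_fun a = [ffun x : assignment V => parity (enum V) x == b] ->
  forall v, v \in sdd_vars a.
Proof.
move=> aE v; apply/negPn/negP => vnotin.
have parE x : sdd_eval a x = (parity (enum V) x == b).
  by move/ffunP/(_ x): aE; rewrite !ffunE.
(* Two assignments that differ only at the missing variable [v]: the diagram cannot separate them,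
   parity does. *)
pose x0 : assignment V := [ffun=> false].
pose x1 : assignment V := [ffun w => w == v].
have p0 : parity (enum V) x0 = false by rewrite /parity big1 // => w _; rewrite ffunE.
have p1 : parity (enum V) x1 = true.
  rewrite -[RHS](@parity_indicator _ (enum V) v) ?enum_uniq ?mem_enum //.
  by apply: eq_bigr => w _; rewrite ffunE.
have: sdd_eval a x0 = sdd_eval a x1.
  apply: sdd_eval_ext => w win; rewrite !ffunE.
  by apply/esym/negbTE; apply: contraNneq vnotin => <-.
by rewrite !parE p0 p1; case: b {aE parE}.
Qed.

End LowerBound.

(** * Locating vtree nodes by preorder position *)

Lemma size_preorder_vshape (V : Type) (t : vtree V) :
  size (preorder (vshape t)) = size (preorder t).
Proof. by elim: t => //= l IHl r IHr; rewrite !size_cat IHl IHr. Qed.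

Lemma leaves_neq_nil (V : eqType) (t : vtree V) : leaves t != [::].
Proof. by elim: t => //= l + r _; case: (leaves l). Qed.

(** The whole contiguous block of the subtree is recorded, not only its first node, so that the
    positions of the children can be derived from it. *)
Definition subtree_at (V : Type) (T t : vtree V) (k : nat) : Prop :=
  exists p q, preorder T = p ++ preorder t ++ q /\ size p = k.

Lemma ID_inv_subtree (V : Type) (T t : vtree V) (k : nat) :
  subtree_at T t k -> ID_inv T (Posz k) = Some t.
Proof. by case=> p [q [/= -> <-]]; elim: p => //=; case: t. Qed.

Local Arguments ID_inv : simpl never.

Lemma subtree_at_left (V : Type) (T l r : vtree V) (k : nat) :
  subtree_at T (VNode l r) k -> subtree_at T l (1 + k).
Proof.
case=> p [q [eqT <-]]; exists (rcons p (VNode l r)), (preorder r ++ q).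
by rewrite eqT size_rcons cat_rcons /= -!catA.
Qed.

(** The right block starts after the node itself and the whole left block. *)
Lemma subtree_at_right (V : Type) (T l r : vtree V) (k : nat) :
  subtree_at T (VNode l r) k -> subtree_at T r ((size (preorder l)).+1 + k).
Proof.
case=> p [q [eqT <-]]; exists (rcons p (VNode l r) ++ preorder l), q.
by rewrite eqT size_cat size_rcons -!catA cat_rcons /= -!catA addSnnS addnC.
Qed.

(* [parity_vs b u] says that the parity of the variables below a node of shape
   [u] equals [b]; offsets are relative to the preorder ID of that node. *)
Fixpoint parity_vs (b : bool) (u : vtree unit) : vstruct :=
  match u with
  | VLeaf _ => VSLit b
  | VNode l r =>
      let e := Posz (size (preorder l)).+1 in
      VSDec [:: ((parity_vs true l, Posz 1), (parity_vs (~~ b) r, e));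
                ((parity_vs false l, Posz 1), (parity_vs b r, e))]
  end.

(** * Parity structures over an arbitrary vtree *)

Section ParityVS.
Variables (V : finType) (T : vtree V).

Lemma vs_fun_parity (t : vtree V) (k : nat) (b : bool) : subtree_at T t k ->
  vs_fun T (parity_vs b (vshape t)) k = [ffun x : assignment V => parity (leaves t) x == b].
Proof.
move=> tk; apply/ffunP => x; rewrite !ffunE.
elim: t k b tk => [v|l IHl r IHr] k b tk.
  by rewrite /= (ID_inv_subtree tk) /parity big_seq1.
rewrite /= -!PoszD size_preorder_vshape.
rewrite !(IHl _ _ (subtree_at_left tk)) !(IHr _ _ (subtree_at_right tk)).
(* The total parity is [b] exactly when the right parity is [~~ b] under an odd left parity, or [b]
   under an even one. *)
by rewrite /parity big_cat /=; case: (bigop _ _ _); case: (bigop _ _ _); case: b.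
Qed.

Lemma parity_partition (vs : seq V) : uniq vs -> vs != [::] ->
  is_partition [:: [ffun x : assignment V => parity vs x == true];
                   [ffun x : assignment V => parity vs x == false]].
Proof.
move=> uvs vs0; have nz b : [ffun x : assignment V => parity vs x == b] != [ffun=> false].
  have [x xb] := parity_surj b uvs vs0.
  by apply/eqP => /ffunP/(_ x); rewrite !ffunE xb eqxx.
rewrite /is_partition /= !nz !andbT; apply/andP; split.
  by apply/forallP => x; rewrite !ffunE; case: parity.
by apply/forallP => x; rewrite !ffunE; case: parity.
Qed.

Lemma vs_wf_parity (t : vtree V) (k : nat) (b : bool) :
  uniq (leaves t) -> subtree_at T t k -> vs_wf T (parity_vs b (vshape t)) k.
Proof.
elim: t k b => [v|l IHl r IHr] k b; first by move=> _ tk; rewrite /= (ID_inv_subtree tk).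
rewrite [leaves _]/= cat_uniq => /and3P[ul _ ur] tk.
have lk := subtree_at_left tk; have rk := subtree_at_right tk.
rewrite /= (ID_inv_subtree tk) -!PoszD size_preorder_vshape.
rewrite !(vs_fun_parity _ lk) parity_partition ?leaves_neq_nil //.
have self (x : vtree V) : x \in preorder x by case: x => *; rewrite mem_head.
by rewrite /ID_in (ID_inv_subtree lk) (ID_inv_subtree rk) !self !IHl ?IHr.
Qed.

Lemma vs_compressed_parity (t : vtree V) (k : nat) (b : bool) :
  subtree_at T t k -> vs_compressed T (parity_vs b (vshape t)) k.
Proof.
elim: t k b => [//|l IHl r IHr] k b tk.
have lk := subtree_at_left tk; have rk := subtree_at_right tk.
rewrite /= -!PoszD size_preorder_vshape !IHl ?IHr // !(vs_fun_parity _ rk).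
(* The two subs are complementary, so any assignment separates them. *)
rewrite inE /= andbT; apply/eqP => /ffunP/(_ [ffun=> false]).
by rewrite !ffunE; case: parity; case: b.
Qed.

End ParityVS.

(** * Perfect vtrees and the linear size bound *)

Fixpoint perfect (V : Type) (g : nat -> V) (j s : nat) : vtree V :=
  if j is i.+1 then VNode (perfect g i s) (perfect g i (s + 2 ^ i))
  else VLeaf (g s).

Lemma leaves_perfect (V : Type) (g : nat -> V) (j s : nat) :
  leaves (perfect g j s) = map g (iota s (2 ^ j)).
Proof.
elim: j s => //= j IHj s.
by rewrite !IHj -map_cat -iotaD addnn -mul2n expnS.
Qed.

Fixpoint perfect_shape (j : nat) : vtree unit :=
  if j is i.+1 then VNode (perfect_shape i) (perfect_shape i) else VLeaf tt.

Lemma vshape_perfect (V : Type) (g : nat -> V) (j s : nat) :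
  vshape (perfect g j s) = perfect_shape j.
Proof. by elim: j s => //= j IHj s; rewrite !IHj. Qed.

Definition dec_elements (a : vstruct) : seq ((vstruct * int) * (vstruct * int)) :=
  if a is VSDec es then es else [::].

(** Each entry carries a shape because [vs_decs] tells equal structures apart by the shape at their
    offset. *)
Definition parity_decs (j : nat) :=
  [seq (dec_elements (parity_vs b (perfect_shape i.+1)), Some (perfect_shape i.+1))
  | i <- iota 0 j, b <- [:: true; false]].

Lemma parity_decs_le (i j : nat) :
  i <= j -> {subset parity_decs i <= parity_decs j}.
Proof.
move=> le_ij u /allpairsP[[h b] /= [hin bin ->]]; apply/allpairsP; exists (h, b).
by split=> //=; move: hin; rewrite !mem_iota !add0n => /leq_trans->.
Qed.

(** Both children of a perfect node have the same shape, hence the same structures at different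
    absolute offsets; they contribute the same entries. *)
Lemma vs_decs_parity (V : finType) (T : vtree V) (g : nat -> V) (j s k : nat) (b : bool) :
  subtree_at T (perfect g j s) k ->
  {subset vs_decs T (parity_vs b (perfect_shape j)) k <= parity_decs j}.
Proof.
elim: j s k b => [|j IHj] s k b tk u //.
have lk : subtree_at T (perfect g j s) _ := subtree_at_left tk.
have rk : subtree_at T (perfect g j _) _ := subtree_at_right tk.
have sizeE : size (preorder (perfect_shape j)) = size (preorder (perfect g j s)).
  by rewrite -(vshape_perfect g j s) size_preorder_vshape.
rewrite /= -!PoszD sizeE (ID_inv_subtree tk).
rewrite inE => /orP[/eqP->|].
  apply/allpairsP; exists (j, b); split.
  - by rewrite mem_iota add0n /=.
  - by case: b.
  - by rewrite /= !vshape_perfect sizeE.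
move=> uin; apply: (parity_decs_le (leqnSn j)); move: uin.
rewrite cats0 !mem_cat => uin.
by case/orP: uin => /orP[/(IHj _ _ _ lk)|/(IHj _ _ _ rk)].
Qed.

Lemma vs_size_parity (V : finType) (T : vtree V) (g : nat -> V) (j s k : nat) (b : bool) :
  subtree_at T (perfect g j s) k ->
  vs_size T (parity_vs b (perfect_shape j)) k <= 4 * j.
Proof.
move=> tk; rewrite /vs_size; set ds := vs_decs _ _ _.
have sub : {subset undup ds <= parity_decs j}.
  by move=> u; rewrite mem_undup; apply: vs_decs_parity tk u.
have -> : \sum_(u <- undup ds) size u.1 = \sum_(u <- undup ds) 2.
  rewrite !big_seq; apply: eq_bigr => u /sub/allpairsP[[i c] [_ _ ->]] //.
rewrite big_const_seq count_predT iter_addn_0 -[4]/(2 * 2) -mulnA leq_pmul2l //.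
rewrite (leq_trans (uniq_leq_size (undup_uniq _) sub)) //.
by rewrite size_allpairs size_iota mulnC.
Qed.

Theorem theorem4 :
  exists (n : nat -> nat) (f : forall j : nat, bfun 'I_(n j)),
    [/\ bigO n (fun j => 2 ^ j),
        exists L : nat -> nat,
          bigOmega L (fun j => 2 ^ j) /\
          forall j : nat, 1 <= j ->
          forall T : vtree 'I_(n j), vtree_over T ->
          forall a : sdd 'I_(n j),
            sdd_wrt T a -> sdd_compressed a -> sdd_fun a = f j ->
            L j <= sdd_size a
      & exists U : nat -> nat,
          bigO U (fun j => j) /\
          forall j : nat, 1 <= j ->
          exists (T : vtree 'I_(n j)) (a : vstruct) (k : int),
            [/\ vtree_over T, vs_wf T a k, vs_compressed T a k,
                vs_fun T a k = f j & vs_size T a k <= U j]].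
Proof.
exists (expn 2), (fun j =>
  [ffun x : assignment 'I_(2 ^ j) => parity (enum 'I_(2 ^ j)) x == true]); split.
- by exists 1, 0 => j _; rewrite mul1n.
(* Half the number of variables, since an element accounts for up to two of them; [1 <= j] provides
   the second variable. *)
- exists (fun j => 2 ^ j.-1); split.
    by exists 2, 1; split=> // -[|j] // _; rewrite expnS.
  case=> // j _ T _ a _ _ /parity_sdd_vars/card_le_sdd_size.
  rewrite card_ord => lower; rewrite -(leq_pmul2l (isT : 0 < 2)) -expnS.
  by apply: lower; rewrite (@ltn_exp2l 2 0).
(* Two decompositions of two elements at each height from 1 to [j]. *)
exists (muln 4); split; first by exists 4, 0.
move=> j _; pose o : 'I_(2 ^ j) := Ordinal (expn_gt0 2 j).
(* The default [o] is never taken: the leaf indices run through [iota 0 (2 ^ j)]. *)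
pose T := perfect (insubd o) j 0.
have leavesT : leaves T = enum 'I_(2 ^ j).
  apply: (inj_map val_inj); rewrite leaves_perfect val_enum_ord -map_comp.
  rewrite -[RHS]map_id; apply/eq_in_map => i; rewrite mem_iota /= => ij.
  by rewrite val_insubd ij.
have T0 : subtree_at T T 0 by exists [::], [::]; rewrite cats0.
have shapeT : vshape T = perfect_shape j by apply: vshape_perfect.
exists T, (parity_vs true (vshape T)), (Posz 0); split.
- by rewrite /vtree_over leavesT.
- by apply: vs_wf_parity T0; rewrite leavesT enum_uniq.
- exact: vs_compressed_parity T0.
- by rewrite (vs_fun_parity _ T0) leavesT.
- by rewrite shapeT; apply: vs_size_parity T0.
Qed.
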